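(* For any tenable balanced $2\times2$ urn with subtraction, with matrix $\begin{pmatrix}-a&a+s\\ b+s&-b\end{pmatrix}$, $h:=a+b+s$ and initial size $t_0$, and any integer $r\ge0$, the $r$th factorial moment $\mathbb{E}\bigl(X_n(X_n-1)\cdots(X_n-r+1)\bigr)$ of the number $X_n$ of balls of the first color at time $n$ is of hypergeometric type: it is a finite linear combination (with coefficients not depending on $n$) of terms of the form $$\frac{\binom{n+t_0/s+\ell-kh/s-1}{n}}{\binom{n+t_0/s-1}{n}},\qquad 0\le k,\ell\le r.$$
   Context: Here $a,b,s$ are positive integers and the urn starts with $a_0$ balls of the first color and $b_0$ of the second, $t_0=a_0+b_0\ge1$. At each time step a ball is drawn uniformly at random, observed and put back; if it is of the first color, $a$ balls of the first color are removed and $a+s$ of the second are added; if it is of the second color, $b+s$ balls of the first color are added and $b$ of the second are removed. Tenability: $a\mid a_0$, $b\mid b_0$, $a\mid b+s$, $b\mid a+s$. Generalized binomial coefficients: $\binom{n+\alpha-1}{n}=\frac{\alpha(\alpha+1)\cdots(\alpha+n-1)}{n!}=[z^n](1-z)^{-\alpha}$ for real $\alpha$; $k,\ell$ are integers. *)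

(* Defs.v *)
From HB Require Import structures.
From mathcomp Require Import all_boot all_order all_algebra.
From mathcomp Require Import all_classical all_reals all_analysis.
From mathcomp Require Import ring.

Set Implicit Arguments.
Unset Strict Implicit.
Unset Printing Implicit Defensive.

Import Order.TTheory GRing.Theory Num.Theory.
Local Open Scope classical_set_scope.
Local Open Scope ring_scope.

(* x (x - 1) ... (x - r + 1), for x in an arbitrary ring *)
Definition ffactr (R : pzRingType) (x : R) (r : nat) : R :=
  \prod_(i < r) (x - i%:R).

(* binomial coefficient with arbitrary upper argument *)
Definition gbinom (R : unitRingType) (x : R) (n : nat) : R :=
  ffactr x n / n`!%:R.

Lemma gbinom_rising (R : fieldType) (alpha : R) (n : nat) :
  gbinom (n%:R + alpha - 1) n = (\prod_(i < n) (alpha + i%:R)) / n`!%:R.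
Proof.
rewrite /gbinom /ffactr (reindex_inj rev_ord_inj) /=.
congr (_ / _); apply: eq_bigr => i _.
by rewrite natrB ?ltn_ord // -natr1; ring.
Qed.

Definition tenable (a b s a0 b0 : nat) : Prop :=
  [/\ a %| a0, b %| b0, a %| b + s & b %| a + s]%N.

(* Composition (first color, second color) of the urn after n draws;
   w i = true when the ball drawn at time i is of the first color.
   Counts are integers, so that removals are not truncated; along impossible
   sequences of draws they may be negative. *)
Fixpoint composition (a b s a0 b0 : nat) (w : nat -> bool) (n : nat) :
    int * int :=
  if n is m.+1 then
    let: (x, y) := composition a b s a0 b0 w m in
    if w m then (x - a%:Z, y + (a + s)%:Z) else (x + (b + s)%:Z, y - b%:Z)
  else (a0%:Z, b0%:Z).

(* D i is the event that the ball drawn at time i is of the first color.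
   Uniformity of the draw at time n is stated conditionally on each history w
   of the first n draws, in the multiplied form
   P(H and D n) = P(H) * proportion of the first color after H,
   which makes sense also when P(H) = 0. *)
Record urn_draws (d : measure_display) (T : measurableType d) (R : realType)
    (P : probability T R) (a b s a0 b0 : nat) (D : nat -> T -> bool) : Prop := {
  measurable_draw : forall n, measurable [set t | D n t];
  uniform_draw : forall (n : nat) (w : nat -> bool),
    let H := [set t | forall i, (i < n)%N -> D i t = w i] in
    let: (x, y) := composition a b s a0 b0 w n in
    P (H `&` [set t | D n t]) = (P H * (x%:~R / (x + y)%:~R)%:E)%E
}.

(* number of balls of the first color at time n, as a random variable *)
Definition first_color (T : Type) (R : pzRingType) (a b s a0 b0 : nat)
    (D : nat -> T -> bool) (n : nat) : T -> R :=
  fun t => (composition a b s a0 b0 (fun i => D i t) n).1%:~R.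

(* Main.v *)
Require Import Defs.
From mathcomp Require Import all_boot all_order all_algebra.
From mathcomp Require Import all_classical all_reals all_analysis.
From mathcomp Require Import measurable_realfun ring.

Set Implicit Arguments.
Unset Strict Implicit.
Unset Printing Implicit Defensive.

Import Order.TTheory GRing.Theory Num.Theory.
Local Open Scope ring_scope.

(** The urn is balanced: after n draws it holds t0 + s n balls whatever the
    draws were. Put tau = t0 / s and eta = h / s. Conditioning the n-th draw on
    the past gives, for every polynomial p,
      (tau + n) E p(X_(n+1)) =
        E [(tau + n) p(X_n + b + s) + (X_n / s) (p(X_n - a) - p(X_n + b + s))].
    For p = X^r the right-hand side has leading part (tau + n - r eta) X^r and
    otherwise involves only polynomials of degree below r, multiplied by
    constants or by tau + n. Multiplying the moments by the rising factorial
    tau (tau + 1) ... (tau + n - 1) clears the factor on the left, and M_n(X^r)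
    then satisfies a first-order linear recurrence
      u (n+1) = (tau + n - r eta) u n + g n,
    where by induction on r the forcing g is a combination of the sequences
      mode k l n = rising (tau + l - k eta) n
    with k < r and l <= r; multiplication by tau + n raises l by one
    ([spanned_mul_time]). Each mode is an eigenvector of the recurrence,
      mode k l (n+1) - (tau + n - r eta) mode k l n
        = ((r - k) eta + l) mode k l n,
    with an eigenvalue that is positive for k < r. Hence there is no resonance,
    and u is a combination of those modes plus a multiple of the homogeneous
    solution mode r 0 ([spanned_solve], [spanned_moments]). Dividing by
    rising tau n turns modes into the announced quotients of binomials.

    On the probabilistic side, the integral of f(X_(n+m), Y_(n+m)) over the
    event that the first n draws form a given word is the probability of that
    event times the m-th iterate of the one-draw averaging operator, evaluated
    at the composition reached by the word ([integral_history]). The case n = 0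
    expresses the expectation through these iterates, so that the recurrence
    above becomes a pointwise identity between functions of the composition
    ([urn_momentS]). *)

(** * Recurrences with rising factorial solutions *)

Section RisingFactorials.
Context {R : realFieldType} (tau eta : R).

Definition rising (x : R) (n : nat) : R := \prod_(i < n) (x + i%:R).

Lemma risingS x n : rising x n.+1 = rising x n * (x + n%:R).
Proof. by rewrite /rising big_ord_recr. Qed.

(** Both sides are x (x + 1) ... (x + n). *)
Lemma rising_shift x n : x * rising (x + 1) n = (x + n%:R) * rising x n.
Proof.
transitivity (rising x n.+1); last by rewrite risingS mulrC.
rewrite /rising big_ord_recl addr0; congr (_ * _).
by apply: eq_bigr => i _; rewrite -addrA -natr1 [1 + _]addrC.
Qed.

Lemma rising_neq0 x n : 0 < x -> rising x n != 0.
Proof.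
move=> x_gt0; apply/prodf_neq0 => i _.
by rewrite gt_eqF // ltr_wpDr.
Qed.

(** Up to the factor [rising tau n], the hypergeometric terms of the theorem. *)
Definition mode (k l n : nat) : R := rising (tau + l%:R - k%:R * eta) n.

Definition spanned (K L : nat) (u : nat -> R) : Prop :=
  exists c : nat -> nat -> R, forall n,
    u n = \sum_(0 <= k < K) \sum_(0 <= l < L) c k l * mode k l n.

Lemma spanned_ext K L u v : u =1 v -> spanned K L u -> spanned K L v.
Proof. by move=> uv [c uE]; exists c => n; rewrite -uv. Qed.

Lemma spanned0 K L : spanned K L (fun=> 0).
Proof.
exists (fun _ _ => 0) => n.
by rewrite big1 // => k _; rewrite big1 // => l _; rewrite mul0r.
Qed.

Lemma spannedD K L u v :
  spanned K L u -> spanned K L v -> spanned K L (fun n => u n + v n).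
Proof.
move=> [c uE] [d vE]; exists (fun k l => c k l + d k l) => n.
rewrite uE vE -big_split; apply: eq_bigr => k _.
by rewrite -big_split; apply: eq_bigr => l _; rewrite mulrDl.
Qed.

Lemma spannedZ K L a u : spanned K L u -> spanned K L (fun n => a * u n).
Proof.
move=> [c uE]; exists (fun k l => a * c k l) => n.
rewrite uE mulr_sumr; apply: eq_bigr => k _.
by rewrite mulr_sumr; apply: eq_bigr => l _; rewrite mulrA.
Qed.

Lemma spanned_sum K L I (e : seq I) (Q : pred I) (u : I -> nat -> R) :
  (forall i, Q i -> spanned K L (u i)) ->
  spanned K L (fun n => \sum_(i <- e | Q i) u i n).
Proof.
move=> uP; elim: e => [|i e IHe].
  by apply: spanned_ext (spanned0 K L) => n; rewrite big_nil.
have [Qi|nQi] := boolP (Q i).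
  by apply: spanned_ext (spannedD (uP i Qi) IHe) => n; rewrite big_cons Qi.
by apply: spanned_ext IHe => n; rewrite big_cons (negbTE nQi).
Qed.

Lemma spanned_mode K L k l : (k < K)%N -> (l < L)%N -> spanned K L (mode k l).
Proof.
move=> ltkK ltlL; exists (fun i j => ((i == k) && (j == l))%:R) => n.
rewrite big_mkord (bigD1 (Ordinal ltkK)) //= [X in _ + X]big1; last first.
  move=> i /eqP neq; rewrite big1 // => j _.
  by case: eqP => [eqik|_]; [case: neq; apply: val_inj | rewrite mul0r].
rewrite addr0 big_mkord (bigD1 (Ordinal ltlL)) //= big1; last first.
  move=> j /eqP neq; rewrite eqxx /=.
  by case: eqP => [eqjl|_]; [case: neq; apply: val_inj | rewrite mul0r].
by rewrite !eqxx mul1r addr0.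
Qed.

Lemma spanned_combine K L K' L' (f : nat -> nat -> nat -> R)
    (c : nat -> nat -> R) :
  (forall k l, (k < K)%N -> (l < L)%N -> spanned K' L' (f k l)) ->
  spanned K' L'
    (fun n => \sum_(0 <= k < K) \sum_(0 <= l < L) c k l * f k l n).
Proof.
move=> fP.
pose S n := \sum_(k < K) \sum_(l < L) c k l * f k l n.
have SP : spanned K' L' S.
  by do 2![apply: spanned_sum => ? _]; apply: spannedZ; apply: fP.
apply: spanned_ext SP => n; rewrite big_mkord; apply: eq_bigr => k _.
by rewrite big_mkord.
Qed.

Lemma spanned_widen K L K' L' u : (K <= K')%N -> (L <= L')%N ->
  spanned K L u -> spanned K' L' u.
Proof.
move=> leK leL [c uE].
have [k l ltk ltl|e eE] := @spanned_combine K L K' L' mode c.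
  by apply: spanned_mode; [apply: leq_trans leK|apply: leq_trans leL].
by exists e => n; rewrite uE eE.
Qed.

(** With x = tau + l - k eta, (x + n) mode k l = x mode k (l + 1) by
    [rising_shift], and tau + n differs from x + n by a constant. *)
Lemma spanned_mul_time K L u :
  spanned K L u -> spanned K L.+1 (fun n => (tau + n%:R) * u n).
Proof.
move=> [c uE].
have shift k l n : (tau + n%:R) * mode k l n =
    (tau + l%:R - k%:R * eta) * mode k l.+1 n + (k%:R * eta - l%:R) * mode k l n.
  have := rising_shift (tau + l%:R - k%:R * eta) n.
  rewrite (_ : _ - _ + 1 = tau + l.+1%:R - k%:R * eta); last first.
    by rewrite -natr1; ring.
  by rewrite -!/(mode _ _ _) => ->; ring.
pose f k l n := (tau + n%:R) * mode k l n.
have [k l ltk ltl|e eE] := @spanned_combine K L K L.+1 f c.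
  apply: spanned_ext (fun n => esym (shift k l n)) _.
  by apply: spannedD; apply: spannedZ; apply: spanned_mode => //; apply: ltnW.
exists e => n; rewrite uE -eE mulr_sumr; apply: eq_bigr => k _.
by rewrite mulr_sumr; apply: eq_bigr => l _; rewrite mulrCA.
Qed.

(** Each mode in the forcing g is an eigenvector of
    u |-> u (n+1) - (tau + n - r eta) u n, for the eigenvalue
    (r - k) eta + l > 0; dividing the coefficients of g by these eigenvalues
    gives a particular solution, and [mode r 0] solves the homogeneous
    equation with value 1 at time 0. *)
Lemma spanned_solve r u g : 0 < eta -> spanned r r.+1 g ->
  (forall n, u n.+1 = (tau + n%:R - r%:R * eta) * u n + g n) ->
  spanned r.+1 r.+1 u.
Proof.
move=> eta_gt0 [c gE] uS.
pose gap k l := (r%:R - k%:R) * eta + l%:R.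
pose v n := \sum_(0 <= k < r) \sum_(0 <= l < r.+1) c k l / gap k l * mode k l n.
have vS n : v n.+1 = (tau + n%:R - r%:R * eta) * v n + g n.
  rewrite gE mulr_sumr -big_split; apply: eq_big_nat => k /andP[_ ltkr].
  rewrite mulr_sumr -big_split; apply: eq_bigr => l _ /=.
  have gap_neq0 : gap k l != 0.
    by rewrite gt_eqF // ltr_wpDr // mulr_gt0 // subr_gt0 ltr_nat.
  rewrite {1}/mode risingS -/(mode _ _ _) -[X in _ + X * _](divfK gap_neq0).
  by set x := c k l / gap k l; rewrite /gap; ring.
have uE n : v n + (u 0%N - v 0%N) * mode r 0 n = u n.
  elim: n => [|n IHn]; first by rewrite /mode /rising big_ord0 mulr1 subrKC.
  by rewrite uS -IHn vS {1}/mode risingS -/(mode _ _ _); ring.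
apply: spanned_ext uE _; apply: spannedD.
  apply: spanned_combine => k l ltkr ltlr.
  by apply: spanned_mode => //; apply: leqW.
by apply: spannedZ; apply: spanned_mode.
Qed.

End RisingFactorials.

(** * Moment recurrences of balanced urns *)

Section Moments.
Context {R : realFieldType}.

(** The first two terms of the Taylor expansion of (X + c)^r, multiplied by X
    so that no predecessor of r occurs. *)
Lemma mulX_shift_expr (c : R) (r : nat) :
  exists2 q : {poly R}, (size q <= r)%N &
    'X * ('X^r \Po ('X + c%:P) - 'X^r) = (r%:R * c) *: 'X^r + q.
Proof.
elim: r => [|r [q sq qE]].
  by exists 0; rewrite ?size_poly0 // comp_polyC subrr mulr0 mul0r scale0r addr0.
exists ((r%:R * c ^+ 2) *: 'X^r + ('X + c%:P) * q).
  apply: leq_trans (size_polyD _ _) _; rewrite geq_max; apply/andP; split.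
    by apply: leq_trans (size_scale_leq _ _) _; rewrite size_polyXn.
  apply: leq_trans (size_polyMleq _ _) _.
  by rewrite size_XaddC.
have -> : 'X * ('X^(r.+1) \Po ('X + c%:P) - 'X^(r.+1)) =
    ('X + c%:P) * ('X * ('X^r \Po ('X + c%:P) - 'X^r)) + c%:P * 'X^(r.+1).
  by rewrite exprS comp_polyM comp_polyX; ring.
by rewrite qE -!mul_polyC exprS -natr1 !(polyCM, polyCD, polyC1); ring.
Qed.

Lemma size_shift_expr_sub (c : R) (r : nat) :
  (size ('X^r \Po ('X + c%:P) - 'X^r)%R <= r)%N.
Proof.
have [q sq qE] := mulX_shift_expr c r.
set d := (_ - _) in qE *; have [->|nz] := eqVneq d 0.
  by rewrite size_poly0.
rewrite -ltnS -size_mulX // mulrC qE.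
apply: leq_trans (size_polyD _ _) _; rewrite geq_max (leqW sq) andbT.
by apply: leq_trans (size_scale_leq _ _) _; rewrite size_polyXn.
Qed.

(** The recurrence on M is the one-step equation of an urn in which a draw
    changes the count of the first color by - alpha or by gamma. Induction on
    the degree reduces to [spanned_solve] for p = X^r, since every other term
    has smaller degree. *)
Lemma spanned_moments (tau sigma alpha gamma : R) (M : nat -> {poly R} -> R) :
  0 < sigma * (alpha + gamma) -> (forall n, scalar (M n)) ->
  (forall n p, M n.+1 p =
     (tau + n%:R) * M n (p \Po ('X + gamma%:P)) +
     sigma * M n ('X * (p \Po ('X + (- alpha)%:P) - (p \Po ('X + gamma%:P))))) ->
  forall r (p : {poly R}), (size p <= r)%N ->
  spanned tau (sigma * (alpha + gamma)) r r (M^~ p).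
Proof.
set eta := sigma * _ => eta_gt0 Mlin MS.
have MD n p q : M n (p + q) = M n p + M n q.
  by rewrite -[p]scale1r Mlin mul1r scale1r.
have MZ n a p : M n (a *: p) = a * M n p.
  have M0 : M n 0 = 0 by apply: (@addrI _ (M n 0)); rewrite -MD !addr0.
  by rewrite -[a *: p]addr0 Mlin M0 addr0.
elim=> [|r IHr] p sp.
  have p0 : p = 0 by apply/eqP; rewrite -size_poly_leq0.
  apply: spanned_ext (spanned0 _ _ 0 0) => n.
  by rewrite p0 -(scale0r 0) MZ mul0r.
(* Split off the leading monomial; the rest of p has smaller degree. *)
suff XrP : spanned tau eta r.+1 r.+1 (M^~ 'X^r).
  pose q := p - p`_r *: 'X^r.
  have sq : (size q <= r)%N.
    apply/leq_sizeP => j; rewrite leq_eqVlt coefB coefZ coefXn.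
    case/predU1P => [<-|ltrj]; first by rewrite eqxx mulr1 subrr.
    by rewrite (gtn_eqF ltrj) mulr0 subr0 nth_default // (leq_trans sp).
  apply: (@spanned_ext _ _ _ _ _ (fun n => p`_r * M n 'X^r + M n q)).
    by move=> n; rewrite -MZ -MD addrC subrK.
  by apply: spannedD; [exact: spannedZ | apply: spanned_widen (IHr q sq)].
set d := 'X^r \Po ('X + gamma%:P) - 'X^r.
have [q1 sq1 q1E] := mulX_shift_expr (- alpha) r.
have [q2 sq2 q2E] := mulX_shift_expr gamma r.
apply: (@spanned_solve _ _ _ _ _
  (fun n => (tau + n%:R) * M n d + sigma * M n (q1 + (-1) *: q2))) => //.
  apply: spannedD; first exact/spanned_mul_time/IHr/size_shift_expr_sub.
  apply/spannedZ/(@spanned_widen _ _ _ r r) => //; apply: IHr.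
  apply: leq_trans (size_polyD _ _) _; rewrite geq_max sq1.
  exact: leq_trans (size_scale_leq _ _) sq2.
move=> n; rewrite MS.
rewrite (_ : 'X^r \Po ('X + gamma%:P) = 'X^r + d); last by rewrite /d subrKC.
rewrite (_ : 'X * _ = (- (r%:R * (alpha + gamma))) *: 'X^r + (q1 + (-1) *: q2)).
  by rewrite !MD !MZ /eta; ring.
transitivity ('X * ('X^r \Po ('X + (- alpha)%:P) - 'X^r) - 'X * d).
  by ring.
by rewrite q1E q2E -!mul_polyC !(polyCM, polyCD, polyCN, polyC1); ring.
Qed.

End Moments.

(** * The one-draw averaging operator *)

Section Urn.
Context {R : realType} (a b s a0 b0 : nat).
Context (s_gt0 : (0 < s)%N) (t0_ge1 : (1 <= a0 + b0)%N).

Local Notation comp := (composition a b s a0 b0).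

Lemma composition_total w n :
  (comp w n).1 + (comp w n).2 = (a0 + b0 + s * n)%N%:Z.
Proof.
elim: n => [|n] /=; first by rewrite muln0 addn0 PoszD.
case: (comp w n) => x y /= IHn; rewrite mulnS addnCA [RHS]PoszD -IHn.
by case: (w n) => /=; rewrite !PoszD; ring.
Qed.

Lemma eq_composition w w' n :
  (forall i, (i < n)%N -> w i = w' i) -> comp w n = comp w' n.
Proof.
elim: n => //= n IHn eqw.
by rewrite IHn => [|i /leqW/eqw //]; rewrite eqw.
Qed.

(** The transition operator of the urn as a Markov chain: [draw_step f z] is
    the mean of f after one draw from the composition z. *)
Definition draw_step (f : int * int -> R) (z : int * int) : R :=
  let tot := (z.1 + z.2)%:~R in
  z.1%:~R / tot * f (z.1 - a%:Z, z.2 + (a + s)%:Z) +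
  z.2%:~R / tot * f (z.1 + (b + s)%:Z, z.2 - b%:Z).

Lemma iter_draw_step_linear n k f g z :
  iter n draw_step (fun z' => k * f z' + g z') z =
  k * iter n draw_step f z + iter n draw_step g z.
Proof.
by elim: n z => //= n IHn z; rewrite /draw_step !IHn; ring.
Qed.

(** Balance: n draws add exactly s n balls, so the iterate only sees f on the
    compositions of that total. *)
Lemma eq_iter_draw_step n f g z :
  (forall z', z'.1 + z'.2 = z.1 + z.2 + (s * n)%N%:Z -> f z' = g z') ->
  iter n draw_step f z = iter n draw_step g z.
Proof.
elim: n z => [|n IHn] z eqfg /=; first by apply: eqfg; rewrite muln0 addr0.
rewrite /draw_step !IHn // => z' /= tot'; apply: eqfg;
  by rewrite tot' mulnS !PoszD; ring.
Qed.

(** The expectation of p(X_n), computed without a probability space (see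
    [expectation_urn]). *)
Definition urn_moment (n : nat) (p : {poly R}) : R :=
  iter n draw_step (fun z => p.[z.1%:~R]) (a0%:Z, b0%:Z).

Lemma urn_moment_scalar n : scalar (urn_moment n).
Proof.
move=> k p q; rewrite -iter_draw_step_linear; apply: eq_iter_draw_step => z _.
by rewrite hornerD hornerZ.
Qed.

(** The last draw is made from a composition with total t0 + s n, so that on the
    compositions that matter the denominator of [draw_step] is the constant
    s (tau + n) and the identity holds pointwise. *)
Lemma urn_momentS n p (tau := (a0 + b0)%:R / s%:R) :
  (tau + n%:R) * urn_moment n.+1 p =
  (tau + n%:R) * urn_moment n (p \Po ('X + (b + s)%:R%:P)) +
  s%:R^-1 * urn_moment n
    ('X * ((p \Po ('X + (- a%:R)%:P)) - (p \Po ('X + (b + s)%:R%:P)))).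
Proof.
have s_neq0 : s%:R != 0 :> R by rewrite pnatr_eq0 -lt0n.
rewrite /urn_moment iterSr.
set U := iter n draw_step.
have UE k f g z : U (fun z' => k * f z' + g z') z = k * U f z + U g z.
  exact: iter_draw_step_linear.
have UZ k f z : U (fun z' => k * f z') z = k * U f z.
  have U0 : U (fun=> 0) z = 0.
    apply: (@addrI _ (U (fun=> 0) z)); rewrite addr0 -[X in X + _]mul1r -UE.
    by apply: eq_iter_draw_step => z' _; rewrite mul1r addr0.
  by rewrite -[RHS]addr0 -U0 -UE; apply: eq_iter_draw_step => z' _; rewrite addr0.
rewrite -[in LHS]UZ -[s%:R^-1 * _]UZ -UE; apply: eq_iter_draw_step => -[x y] /= tot.
rewrite /draw_step /= tot.
have tauE : tau + n%:R = (a0%:Z + b0%:Z + (s * n)%N%:Z)%:~R / s%:R.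
  by rewrite !intrD /= -!pmulrn /tau natrM natrD; field.
have tau_neq0 : tau + n%:R != 0.
  by rewrite gt_eqF // ltr_wpDr // divr_gt0 // ltr0n.
have tot_neq0 : (a0%:Z + b0%:Z + (s * n)%N%:Z)%:~R != 0 :> R.
  by apply: contra_neq tau_neq0 => tot0; rewrite tauE tot0 mul0r.
have yE : y%:~R = (a0%:Z + b0%:Z + (s * n)%N%:Z)%:~R - x%:~R :> R.
  by rewrite -tot intrD addrC addKr.
rewrite hornerM hornerD hornerN !horner_comp !hornerD !hornerX !hornerC.
rewrite tauE yE !intrD !intrN -!pmulrn.
move: tot_neq0; rewrite !intrD -!pmulrn => tot_neq0.
by field; rewrite s_neq0 -natrM.
Qed.

End Urn.

(** * Expectations along the random sequence of draws *)

Section Expectation.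
Context {R : realType} {d : measure_display} {T : measurableType d}.
Context (P : probability T R) (a b s a0 b0 : nat) (D : nat -> T -> bool).
Context (s_gt0 : (0 < s)%N) (t0_ge1 : (1 <= a0 + b0)%N).
Context (D_urn : urn_draws P a b s a0 b0 D).

Local Open Scope classical_set_scope.
Local Notation comp := (composition a b s a0 b0).
Local Notation step := (draw_step a b s).

(** Words of draws are infinite sequences of which only the first n letters
    matter, hence [extend], which overwrites the letter at time n. *)
Definition history (n : nat) (w : nat -> bool) : set T :=
  [set t | forall i, (i < n)%N -> D i t = w i].

Definition extend (n : nat) (w : nat -> bool) (v : bool) : nat -> bool :=
  fun i => if i == n then v else w i.

Lemma history0 w : history 0 w = setT.
Proof. by apply/seteqP; split. Qed.

Lemma extendE n w v i : (i < n)%N -> extend n w v i = w i.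
Proof. by move=> ltin; rewrite /extend ltn_eqF. Qed.

Lemma history_extend n w v :
  history n.+1 (extend n w v) = history n w `&` [set t | D n t = v].
Proof.
apply/seteqP; split=> t /=.
  move=> Ht; split=> [i ltin|]; first by rewrite Ht ?leqW // extendE.
  by rewrite Ht // /extend eqxx.
move=> [Ht Dv] i; rewrite ltnS leq_eqVlt => /predU1P[->|ltin].
  by rewrite /extend eqxx.
by rewrite extendE // Ht.
Qed.

Lemma measurable_history n w : measurable (history n w).
Proof.
elim: n => [|n IHn]; first by rewrite history0.
have -> : history n.+1 w = history n.+1 (extend n w (w n)).
  by apply/seteqP; split=> t Ht i ltin; rewrite Ht // /extend; case: eqP => // ->.
rewrite history_extend; apply: measurableI => //.
have mD := measurable_draw D_urn n.
case: (w n); first exact: mD.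
rewrite (_ : [set t | _] = ~` [set t | D n t]); first exact: measurableC.
by apply/seteqP; split=> t /= => [->|/negP/negbTE].
Qed.

Lemma history_split n w :
  history n w = history n.+1 (extend n w true) `|` history n.+1 (extend n w false).
Proof.
rewrite !history_extend; apply/seteqP; split=> t /=; last by case=> -[].
by case: (D n t) => Ht; [left|right].
Qed.

Lemma history_disjoint n w :
  [disjoint history n.+1 (extend n w true) & history n.+1 (extend n w false)].
Proof.
by rewrite !history_extend; apply/disj_setPS => t /= [[_ ->] [_]].
Qed.

(** The law of the draws gives the case of the first color; the second color
    follows by complement, the two proportions adding up to 1 because the urn is
    never empty. *)
Lemma probability_extend n w v (z := comp w n) :
  P (history n.+1 (extend n w v)) =
  (P (history n w) * ((if v then z.1 else z.2)%:~R / (z.1 + z.2)%:~R)%:E)%E.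
Proof.
have Ptrue : P (history n.+1 (extend n w true)) =
    (P (history n w) * (z.1%:~R / (z.1 + z.2)%:~R)%:E)%E.
  rewrite history_extend; have := uniform_draw D_urn n w.
  by rewrite /z; case: (comp w n).
case: v => //.
have tot_neq0 : (z.1 + z.2)%:~R != 0 :> R.
  by rewrite composition_total intr_eq0 -lt0n addn_gt0 t0_ge1.
have Pfin w' m : P (history m w') \is a fin_num.
  exact/fin_num_measure/measurable_history.
have : P (history n w) = (P (history n.+1 (extend n w true)) +
    P (history n.+1 (extend n w false)))%E.
  rewrite [in LHS]history_split measureU //; try exact: measurable_history.
  exact/disj_set2P/history_disjoint.
rewrite Ptrue.
rewrite -(fineK (Pfin w n)) -(fineK (Pfin (extend n w false) n.+1)).
rewrite -!EFinM -EFinD => -[PE]; congr (_%:E).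
apply: (addrI (fine (P (history n w)) * (z.1%:~R / (z.1 + z.2)%:~R))).
by rewrite -PE -mulrDr -mulrDl -intrD divff ?mulr1.
Qed.

(** Induction on m: the event splits according to the draw at time n into two
    histories of length n + 1, whose probabilities are those of [draw_step].
    For m = 0 the integrand is constant on the event. Measurability is proved
    along, since additivity of the integral over the two parts requires it. *)
Lemma integral_history (f : int * int -> R) m n w :
  measurable_fun (history n w) (fun t => (f (comp (D^~ t) (n + m)%N))%:E) /\
  (\int[P]_(t in history n w) (f (comp (D^~ t) (n + m)%N))%:E =
   P (history n w) * (iter m step f (comp w n))%:E)%E.
Proof.
elim: m n w => [|m IHm] n w.
  have constF : {in history n w, (fun t => (f (comp (D^~ t) (n + 0)))%:E) =1
      cst (f (comp w n))%:E}.
    by move=> t; rewrite inE addn0 => Ht; rewrite (eq_composition _ _ _ _ _ Ht).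
  split.
    apply: eq_measurable_fun (fun t Ht => esym (constF t Ht)) _.
    exact: measurable_cst.
  rewrite (eq_integral _ _ constF) integral_cst 1?muleC //.
  exact: measurable_history.
have [] := IHm n.+1 (extend n w true); have [] := IHm n.+1 (extend n w false).
rewrite addSnnS => mf intf mt intt.
have mU : measurable_fun (history n w) (fun t => (f (comp (D^~ t) (n + m.+1)))%:E).
  by rewrite history_split; apply/measurable_funU => //; exact: measurable_history.
split=> //; rewrite {1}history_split integral_setU -?history_split //.
- rewrite intf intt !probability_extend.
  have ext v : comp (extend n w v) n = comp w n.
    by apply: eq_composition => i; exact: extendE.
  have Pfin : P (history n w) \is a fin_num.
    exact/fin_num_measure/measurable_history.
  rewrite -(fineK Pfin) -!EFinM -EFinD /= !ext /extend eqxx /draw_step.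
  by case: (comp w n) => x y /=; congr (_%:E); ring.
- exact: measurable_history.
- exact: measurable_history.
- exact: history_disjoint.
Qed.

Lemma expectation_urn (p : {poly R}) n :
  ('E_P[fun t => p.[first_color R a b s a0 b0 D n t]] =
   (urn_moment a b s a0 b0 n p)%:E)%E.
Proof.
have [_] := integral_history (fun z => p.[z.1%:~R]) n 0 (fun=> true).
by rewrite history0 probability_setT mul1e unlock.
Qed.

End Expectation.

(** * Factorial moments *)

Lemma ffactr_horner (R : comNzRingType) (x : R) r :
  ffactr x r = (\prod_(i < r) ('X - i%:R%:P)).[x].
Proof.
by rewrite horner_prod; apply: eq_bigr => i _; rewrite hornerXsubC.
Qed.

Theorem corollary3 (R : realType) (d : measure_display) (T : measurableType d)
    (P : probability T R) (a b s a0 b0 : nat) (D : nat -> T -> bool)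
    (a_gt0 : (0 < a)%N) (b_gt0 : (0 < b)%N) (s_gt0 : (0 < s)%N)
    (t0_ge1 : (1 <= a0 + b0)%N)
    (urn_tenable : tenable a b s a0 b0)
    (D_urn : urn_draws P a b s a0 b0 D)
    (r : nat) :
  let h := (a + b + s)%N in
  let t0 := (a0 + b0)%N in
  exists c : nat -> nat -> R, forall n : nat,
    ('E_P[fun t => ffactr (first_color R a b s a0 b0 D n t) r] =
     (\sum_(0 <= k < r.+1) \sum_(0 <= l < r.+1)
        c k l *
        (gbinom (n%:R + t0%:R / s%:R + l%:R - k%:R * h%:R / s%:R - 1) n
         / gbinom (n%:R + t0%:R / s%:R - 1) n))%:E)%E.
Proof.
move=> h t0; pose tau : R := t0%:R / s%:R.
pose p : {poly R} := \prod_(i < r) ('X - i%:R%:P).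
pose M n q := rising tau n * urn_moment a b s a0 b0 n q.
have s_neq0 : s%:R != 0 :> R by rewrite pnatr_eq0 -lt0n.
have tau_gt0 : 0 < tau by rewrite divr_gt0 // ltr0n.
have eta_gt0 : 0 < (s%:R^-1 : R) * (a%:R + (b + s)%:R).
  by rewrite mulr_gt0 ?invr_gt0 ?ltr0n // -natrD ltr0n addn_gt0 a_gt0.
have [|||c cE] := @spanned_moments R tau _ _ _ M eta_gt0 _ _ r.+1 p.
- by move=> n k u v; rewrite /M urn_moment_scalar; ring.
- move=> n q; rewrite /M risingS -mulrA urn_momentS // -/t0 -/tau; ring.
- by rewrite /p size_prod_XsubC [index_enum _]unlock -enumT size_enum_ord.
exists c => n.
rewrite (_ : (fun t => _) = fun t => p.[first_color R a b s a0 b0 D n t]); last first.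
  by apply/funext => t; exact: ffactr_horner.
rewrite expectation_urn //; congr (_%:E).
apply: (mulfI (rising_neq0 n tau_gt0)); rewrite -/(M n p) cE.
rewrite mulr_sumr; apply: eq_bigr => k _.
rewrite mulr_sumr; apply: eq_bigr => l _.
rewrite mulrCA; congr (_ * _).
have modeE : n%:R + t0%:R / s%:R + l%:R - k%:R * h%:R / s%:R - 1 =
    n%:R + (tau + l%:R - k%:R * (s%:R^-1 * (a%:R + (b + s)%:R))) - 1.
  by rewrite /tau /h !natrD; field.
rewrite modeE !gbinom_rising -!/(rising _ _) -/(mode _ _ _ _ _).
have fact_neq0 : n`!%:R != 0 :> R by rewrite pnatr_eq0 -lt0n fact_gt0.
by field; rewrite fact_neq0 rising_neq0.
Qed.
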